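(* There is a first order sentence $\phi$ over a vocabulary consisting of only one ternary relation symbol such that the sequence $Sp_{\phi}(n)$ is not MC-finite.
   Context: Notation: $[n]=\{1,\ldots,n\}$. For a sentence $\phi$ over a single ternary relation symbol $R$, $Sp_{\phi}(n)=|\{A\subseteq[n]^3 : ([n],A)\models\phi\}|$, the number of interpretations of $R$ on $[n]$ that satisfy $\phi$. First order logic includes equality. MC-finite: an integer sequence $s(n)$ is MC-finite if for every positive integer $m$ it satisfies a linear recurrence with constant coefficients modulo $m$: there are $r(m),p(m)\in\mathbb{N}^+$ and integers $\alpha_0,\ldots,\alpha_{p(m)}$ (depending on $m$) such that $s(n+p(m)+1)\equiv\sum_{i=0}^{p(m)}\alpha_i\, s(n+i)\pmod m$ for all $n\ge r(m)$. Equivalently, for every $m$ the sequence $s(n)\bmod m$ is ultimately periodic. *)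

(* Defs.v *)
From mathcomp Require Import all_boot all_order all_algebra.

Set Implicit Arguments.
Unset Strict Implicit.
Unset Printing Implicit Defensive.

Import GRing.Theory Num.Theory.

(* First order formulas with equality over one ternary relation symbol, with
   free variables among 'I_k.  Variables are well-scoped de Bruijn indices:
   under a quantifier, index 0 is the newly bound variable and index i.+1 is
   the variable i of the surrounding context. *)
Inductive formula : nat -> Type :=
| FFalse k : formula k
| FEq k (x y : 'I_k) : formula k
| FRel k (x y z : 'I_k) : formula k
| FNot k (f : formula k) : formula k
| FAnd k (f g : formula k) : formula k
| FOr k (f g : formula k) : formula k
| FImp k (f g : formula k) : formula k
| FForall k (f : formula k.+1) : formula k
| FExists k (f : formula k.+1) : formula k.

Definition sentence := formula 0.

Definition env_cons (T : Type) k (a : T) (e : 'I_k -> T) : 'I_k.+1 -> T :=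
  fun i => if unlift ord0 i is Some j then e j else a.

Definition env_nil (T : Type) : 'I_0 -> T :=
  fun i => False_rect T (notF (ltn_ord i)).

Fixpoint holds (T : finType) (A : {set T * T * T}) k (f : formula k) :
    ('I_k -> T) -> bool :=
  match f in formula k return ('I_k -> T) -> bool with
  | FFalse _ => fun e => false
  | FEq _ x y => fun e => e x == e y
  | FRel _ x y z => fun e => (e x, e y, e z) \in A
  | FNot _ f => fun e => ~~ holds A f e
  | FAnd _ f g => fun e => holds A f e && holds A g e
  | FOr _ f g => fun e => holds A f e || holds A g e
  | FImp _ f g => fun e => holds A f e ==> holds A g e
  | FForall _ f => fun e => [forall a : T, holds A f (env_cons a e)]
  | FExists _ f => fun e => [exists a : T, holds A f (env_cons a e)]
  end.

Definition models (T : finType) (A : {set T * T * T}) (phi : sentence) : bool :=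
  holds A phi (@env_nil T).

(* The universe {1, ..., n} is represented by 'I_n = {0, ..., n-1}. *)
Definition Sp (phi : sentence) (n : nat) : nat :=
  #|[set A : {set 'I_n * 'I_n * 'I_n} | models A phi]|.

Definition MC_finite (s : nat -> int) : Prop :=
  forall m : nat, 0 < m ->
  exists (r p : nat) (alpha : 'I_p.+1 -> int),
    [/\ 0 < r, 0 < p &
      forall n : nat, r <= n ->
        (s (n + p + 1)%N = (\sum_(i < p.+1) alpha i * s (n + i)%N)%R
           %[mod m%:Z])%Z].

(* Main.v *)
Require Import Defs.
From mathcomp Require Import all_boot all_order all_algebra.
From mathcomp Require Import all_fingroup cyclic pgroup sylow.
From mathcomp Require Import zify.

Set Implicit Arguments.
Unset Strict Implicit.
Unset Printing Implicit Defensive.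

(* View the 2^a points as the leaves of the complete binary tree of height a.
   Its automorphism group is a 2-group, so the parity of the number of models of
   a sentence on 2^a points is the parity of the number of models invariant under
   that group.  An invariant ternary relation only depends on the shape of a
   triple, i.e. on which point branches off first and on the two levels j < i at
   which the triple branches; so besides the tree itself it can carry a binary
   relation rho on the linearly ordered set of levels {0, ..., a}.  A first order
   sentence can say that rho is invariant under the shift
   (j, i) -> (j + 1, i + 1), that the set of differences i - j of related pairs
   is closed under addition and subtraction, and that 0 is related to a; then rho
   is congruence modulo a divisor of a.  Hence Sp(2^a) has the parity of the
   number of divisors of a, which is odd exactly when a is a square.  Since 2^a
   is ultimately periodic modulo every q, an ultimately periodic Sp modulo 2 would
   make the set of squares ultimately periodic. *)

(** * First order sentences and finite cardinals *)

Import GRing.Theory.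

Lemma env_cons0 (T : Type) k (a : T) (e : 'I_k -> T) : env_cons a e ord0 = a.
Proof. by rewrite /env_cons unlift_none. Qed.

Lemma env_consS (T : Type) k (a : T) (e : 'I_k -> T) i :
  env_cons a e (lift ord0 i) = e i.
Proof. by rewrite /env_cons liftK. Qed.

Definition env_consE := (env_cons0, env_consS).

Lemma holds_iso (T T' : finType) (f : T -> T') (A : {set T * T * T})
    (A' : {set T' * T' * T'}) :
    bijective f ->
    (forall x y z, ((f x, f y, f z) \in A') = ((x, y, z) \in A)) ->
  forall k (phi : formula k) e e', (forall i, e' i = f (e i)) ->
  holds A' phi e' = holds A phi e.
Proof.
move=> [g fK gK] fA k phi.
have ext k0 e e' a a' : a' = f a -> (forall i, e' i = f (e i)) ->
    forall i : 'I_k0.+1, env_cons a' e' i = f (env_cons a e i).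
  by move=> -> fe i; rewrite /env_cons; case: (unlift _ _).
elim: phi => {k} //=.
- by move=> k x y e e' fe; rewrite !fe (can_eq fK).
- by move=> k x y z e e' fe; rewrite !fe.
- by move=> k phi IH e e' fe; rewrite (IH e).
- by move=> k phi IH psi IH' e e' fe; rewrite (IH e) ?(IH' e).
- by move=> k phi IH psi IH' e e' fe; rewrite (IH e) ?(IH' e).
- by move=> k phi IH psi IH' e e' fe; rewrite (IH e) ?(IH' e).
- move=> k phi IH e e' fe; apply/forallP/forallP => H a.
    by rewrite -(IH _ (env_cons (f a) e')) //; apply: ext.
  by rewrite (IH (env_cons (g a) e)) //; apply: ext.
- move=> k phi IH e e' fe; apply/existsP/existsP => -[a H].
    by exists (g a); rewrite -(IH _ (env_cons a e')) //; apply: ext.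
  by exists (f a); rewrite (IH (env_cons a e)) //; apply: ext.
Qed.

Lemma models_iso (T T' : finType) (f : T -> T') (A : {set T * T * T})
    (A' : {set T' * T' * T'}) phi :
    bijective f ->
    (forall x y z, ((f x, f y, f z) \in A') = ((x, y, z) \in A)) ->
  models A' phi = models A phi.
Proof. by move=> bij_f fA; apply: (holds_iso bij_f fA) => -[]. Qed.

(** This lets the 2^a points be the boolean functions on ['I_a]. *)
Lemma Sp_card (T : finType) phi :
  Sp phi #|T| = #|[set A : {set T * T * T} | models A phi]|.
Proof.
pose f := @enum_val T T; pose g := @enum_rank T.
pose F (A : {set T * T * T}) := [set t | (f t.1.1, f t.1.2, f t.2) \in A].
pose G (A : {set 'I_#|T| * 'I_#|T| * 'I_#|T|}) :=
  [set t | (g t.1.1, g t.1.2, g t.2) \in A].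
have FK : cancel F G.
  by move=> A; apply/setP => -[[x y] z]; rewrite !inE /= /f /g !enum_rankK.
have GK : cancel G F.
  by move=> A; apply/setP => -[[x y] z]; rewrite !inE /= /f /g !enum_valK.
rewrite /Sp -(on_card_preimset (f := F)); last first.
  by exists G => A _; rewrite ?FK ?GK.
apply: eq_card => A; rewrite !inE; apply/esym/models_iso; first exact: enum_val_bij.
by move=> x y z; rewrite inE.
Qed.

(** * Ultimate periodicity and squares *)

(** Pigeonhole: two of the [#|U|.+1] values from index r on coincide, and from there on the sequence
    repeats. *)
Lemma ultimately_periodic_next (U : finType) (w : nat -> U) r :
    (forall n1 n2, r <= n1 -> r <= n2 -> w n1 = w n2 -> w n1.+1 = w n2.+1) ->
  exists q N, 0 < q /\ forall n, N <= n -> w (n + q) = w n.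
Proof.
move=> w_next; pose h (i : 'I_#|U|.+1) := w (r + i).
have [i [j [lt_ij eq_h]]] : exists i j : 'I_#|U|.+1, i < j /\ h i = h j.
  have /injectivePn [i [j ne_ij eq_h]] : ~~ injectiveb h.
    by apply/injectiveP => /leq_card; rewrite card_ord ltnn.
  have [lt_ij|lt_ji|/val_inj eq_ij] := ltngtP i j.
  - by exists i, j.
  - by exists j, i.
  - by rewrite eq_ij eqxx in ne_ij.
exists (j - i), (r + i); split; first by rewrite subn_gt0.
move=> n le_n; rewrite -(subnKC le_n); elim: (n - _) => [|k IHk].
  have -> : r + i + 0 + (j - i) = r + j by lia.
  by rewrite addn0; apply/esym.
have -> : r + i + k.+1 + (j - i) = (r + i + k + (j - i)).+1 by lia.
rewrite addnS; apply: w_next => //; lia.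
Qed.

(** The parities of p + 1 consecutive terms form a finite state, and the recurrence makes each state
    determine the next. *)
Lemma MC_finite_periodic (s : nat -> nat) :
    MC_finite (fun n => Posz (s n)) ->
  exists q N, 0 < q /\ forall n, N <= n -> odd (s (n + q)) = odd (s n).
Proof.
move=> /(_ 2 isT) [r [p [alpha [_ _ rec]]]].
pose w n := [ffun i : 'I_p.+1 => odd (s (n + i))].
suff /ultimately_periodic_next [q [N [q0 per]]] n1 n2 :
    r <= n1 -> r <= n2 -> w n1 = w n2 -> w n1.+1 = w n2.+1.
  exists q, N; split=> // n le_n; have /ffunP/(_ ord0) := per n le_n.
  by rewrite !ffunE /= !addn0.
have mod2 (m : nat) : (m %% 2)%Z = Posz (odd m) by rewrite modz_nat modn2.
move=> le1 le2 eq_w; have e i : (i < p.+1)%N -> odd (s (n1 + i)) = odd (s (n2 + i)).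
  by move=> lt_i; have /ffunP/(_ (Ordinal lt_i)) := eq_w; rewrite !ffunE.
apply/ffunP=> i; rewrite !ffunE !addSnnS.
have [lt_i|] := ltnP i.+1 p.+1; first exact: e.
(* Only the last entry of the shifted window is new; the recurrence modulo 2 computes it. *)
move=> le_i; have -> : i.+1 = p + 1 by have := ltn_ord i; lia.
rewrite !addnA; apply: (can_inj oddb); apply/eqP; rewrite -eqz_nat -!mod2.
rewrite rec // (rec n2) // eqz_mod_dvd -sumrB.
apply: rpred_sum => k _; rewrite -mulrBr.
by apply: dvdz_mull; rewrite -eqz_mod_dvd !mod2 eqz_nat e.
Qed.

(** Take d to be the least positive element of D and subtract it repeatedly, as in Euclid's
    algorithm; [D a] then gives d | a. *)
Lemma difference_set_multiples (a : nat) (D : nat -> bool) :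
    0 < a -> D a ->
    (forall i k, 0 < i -> 0 < k -> i + k <= a -> D i -> D k = D (i + k)) ->
  exists2 d, d %| a & forall k, 0 < k -> k <= a -> D k = (d %| k).
Proof.
move=> a0 Da Dadd; have exD : exists k, (0 < k) && D k by exists a; rewrite a0.
case: (ex_minnP exD) => d /andP[d0 Dd] minD.
suff DE k : 0 < k -> k <= a -> D k = (d %| k) by exists d => //; rewrite -DE.
elim/ltn_ind: k => k IHk k0 le_ka; have [lt_kd|lt_dk|eq_kd] := ltngtP k d.
- rewrite gtnNdvd //; apply/negP => Dk.
  by have := minD k; rewrite k0 Dk leqNgt lt_kd => /(_ isT).
- have eq_k : k = d + (k - d) by lia.
  have -> : D k = D (k - d) by rewrite {1}eq_k -Dadd //; lia.
  rewrite IHk; [|lia|lia|lia].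
  by rewrite [in RHS]eq_k dvdn_addr.
- by rewrite eq_kd dvdnn Dd.
Qed.

(** The involution d -> a / d swaps the divisors below and above the square root of a, so only an
    integral root is left unpaired. *)
Lemma odd_card_divisors a : 0 < a ->
  odd #|[set d : 'I_a.+1 | d %| a]| = [exists k : 'I_a.+1, k * k == a].
Proof.
move=> a0; pose D := [set d : 'I_a.+1 | d %| a]; rewrite -/D.
pose f (d : 'I_a.+1) : 'I_a.+1 := inord (a %/ d).
have fE d : val (f d) = a %/ d by rewrite /= inordK // ltnS leq_div.
have fD d : d \in D -> f d \in D /\ f (f d) = d.
  rewrite !inE => dvd_d; split; first by rewrite fE dvdn_div.
  by apply: val_inj; rewrite !fE divnA // mulKn.
have fM d : d \in D -> d * f d = a by rewrite inE fE => /divnK; rewrite mulnC.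
pose Dl := [set d in D | d * d < a]; pose Dg := [set d in D | a < d * d].
pose De := [set d in D | d * d == a].
have cardD : #|D| = #|Dl| + (#|De| + #|Dg|).
  rewrite -(cardsID Dl D); congr (_ + _).
    by apply: eq_card => d; rewrite !inE andbA andbb.
  rewrite -(cardsID De (D :\: Dl)); congr (_ + _);
    by apply: eq_card => d; rewrite !inE; lia.
rewrite {}cardD; have <- : #|Dl| = #|Dg|.
  have fDl d : d \in Dl -> f d \in Dg.
    rewrite !inE => /andP[Dd lt_d]; have := fM d; have := fD d.
    rewrite !inE => /(_ Dd)[-> _] /(_ Dd) eq_a /=; nia.
  have fDg d : d \in Dg -> f d \in Dl.
    rewrite !inE => /andP[Dd lt_d]; have := fM d; have := fD d.
    rewrite !inE => /(_ Dd)[-> _] /(_ Dd) eq_a /=; nia.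
  have DlD d : d \in Dl -> d \in D by rewrite inE => /andP[].
  have DgD d : d \in Dg -> d \in D by rewrite inE => /andP[].
  rewrite -(card_in_imset (f := f) (D := mem Dl)); last first.
    move=> d d' /DlD /fD[_ fK] /DlD /fD[_ fK'] eq_f; by rewrite -fK eq_f.
  apply: eq_card => d; apply/imsetP/idP => [[d' /fDl Dd' -> //]|Dd].
  by exists (f d); [apply: fDg | case: (fD _ (DgD _ Dd))].
rewrite addnCA addnn oddD odd_double addbF.
have DeE d : (d \in De) = (d * d == a :> nat).
  by rewrite !inE; apply: andb_idl => /eqP eq_a; apply/dvdnP; exists d.
have [De0|[k Dek]] := set_0Vmem De.
  by rewrite De0 cards0; apply/esym/existsP => -[k]; rewrite -DeE De0 inE.
have -> : De = [set k].
  apply/setP=> d; rewrite in_set1 DeE; move: Dek; rewrite DeE => /eqP eq_k.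
  by apply/eqP/eqP => [eq_d|-> //]; apply: val_inj => /=; nia.
by rewrite cards1; apply/esym/existsP; exists k; rewrite -DeE.
Qed.

Lemma odd_squares_not_MC_finite (s : nat -> nat) :
    (forall a, 0 < a ->
       odd (s (2 ^ a)) = [exists k : 'I_a.+1, k * k == a]) ->
  ~ MC_finite (fun n => Posz (s n)).
Proof.
move=> s_sq /MC_finite_periodic [q [N [q0 per]]].
have perM k n : N <= n -> odd (s (n + k * q)) = odd (s n).
  move=> le_n; elim: k => [|k IHk]; first by rewrite addn0.
  by rewrite mulSn (addnC q) addnA per // (leq_trans le_n) ?leq_addr.
pose w n : 'I_q := Ordinal (ltn_pmod (2 ^ n) q0).
have w_next n1 n2 : 0 <= n1 -> 0 <= n2 -> w n1 = w n2 -> w n1.+1 = w n2.+1.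
  move=> _ _ [eq_w]; apply: val_inj.
  by rewrite /= !expnS -modnMmr eq_w modnMmr.
have [t [M [t0 perw]]] := ultimately_periodic_next w_next.
(* The summands ensure 2^a >= N, a >= M and k^2 < a + t < (k + 1)^2, so that a + t is not a
   square. *)
pose k := N + M + t; pose a := k * k.
have le_k : k <= a by rewrite /a; nia.
have le_a : a < 2 ^ a by apply: ltn_expl.
have : odd (s (2 ^ a)).
  rewrite s_sq; last by rewrite /a /k; nia.
  by apply/existsP; exists (Ordinal (le_k : k < a.+1)).
have [c eq_c] : exists c, 2 ^ (a + t) = 2 ^ a + c * q.
  have /(congr1 val) /= eq_w : w (a + t) = w a by apply: perw; rewrite /k in le_k; lia.
  have le2 : 2 ^ a <= 2 ^ (a + t) by rewrite leq_exp2l ?leq_addr.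
  exists (2 ^ (a + t) %/ q - 2 ^ a %/ q).
  have := leq_mul (leq_div2r q le2) (leqnn q); rewrite mulnBl.
  have := divn_eq (2 ^ (a + t)) q; have := divn_eq (2 ^ a) q; rewrite eq_w.
  by move: (_ %% q) (_ %/ q * q) (_ %/ q * q) => u v v'; lia.
rewrite -(perM c); last by rewrite /k in le_k; lia.
rewrite -eq_c s_sq; last by lia.
case/existsP=> -[j /= _] /eqP; rewrite /a.
have : t <= k by rewrite leq_addl.
move: {le_k le_a eq_c a} k => k le_tk eq_j.
have lt_kj : k < j by nia.
by nia.
Qed.

(** * The complete binary tree and its automorphisms *)

Section Tree.

Variable a : nat.
Local Notation T := {ffun 'I_a -> bool}.
Implicit Types (x y z w t : T) (g : {perm T}).

(* The height of the least common ancestor of the leaves x and y, coordinate i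
   of a leaf being the branch taken at height i + 1. *)
Definition dist x y := \max_(i < a | x i != y i) i.+1.

Lemma dist_leP x y r :
  reflect (forall i : 'I_a, r <= i -> x i = y i) (dist x y <= r).
Proof.
apply: (iffP (bigmax_leqP _ _ _)) => H i.
  by move=> le_ri; apply/eqP/contraT => /H; rewrite ltnNge le_ri.
by apply: contraNleq => le_ri; apply/eqP/H.
Qed.

Lemma dist_max x y : dist x y <= a.
Proof. by apply/dist_leP => i; rewrite leqNgt ltn_ord. Qed.

Lemma distC x y : dist x y = dist y x.
Proof. by apply: eq_bigl => i; rewrite eq_sym. Qed.

Lemma dist_eq0 x y : (dist x y == 0) = (x == y).
Proof.
rewrite -leqn0; apply/dist_leP/eqP => [eq_xy|-> //].
by apply/ffunP => i; apply: eq_xy.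
Qed.

Lemma distxx x : dist x x = 0. Proof. by apply/eqP; rewrite dist_eq0. Qed.

Lemma dist_trans r y x z : dist x y <= r -> dist y z <= r -> dist x z <= r.
Proof.
move=> /dist_leP le_xy /dist_leP le_yz; apply/dist_leP => i le_ri.
by rewrite le_xy ?le_yz.
Qed.

Lemma dist_isosceles x y z : dist x y < dist y z -> dist x z = dist y z.
Proof.
move=> lt_xy; apply/eqP; rewrite eqn_leq (dist_trans (ltnW lt_xy)) //=.
rewrite leqNgt; apply/negP => lt_xz.
have: dist y z <= (dist y z).-1 by apply: (@dist_trans _ x); [rewrite distC|]; lia.
by lia.
Qed.

(** A node at height r + 1 has two children; x and z both lie under the one that avoids y. *)
Lemma dist_binary r x y z : dist x y = r.+1 -> dist y z = r.+1 -> dist x z <= r.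
Proof.
have top u v : dist u v = r.+1 ->
    forall i : 'I_a, r <= i -> (u i == v i) = (r != i).
  move=> d_uv i; rewrite leq_eqVlt => /orP[/eqP eq_ri|lt_ri]; last first.
    by rewrite neq_ltn lt_ri; apply/eqP; move: i lt_ri; apply/dist_leP; rewrite d_uv.
  rewrite eq_ri eqxx; apply/negP => /eqP eq_i.
  suff: dist u v <= r by rewrite d_uv ltnn.
  apply/dist_leP => k; rewrite leq_eqVlt => /orP[/eqP eq_rk|]; last first.
    by move: k; apply/dist_leP; rewrite d_uv.
  by have -> : k = i by apply: val_inj; rewrite /= -eq_ri.
move=> /top xy /top yz; apply/dist_leP => i le_ri.
move: (xy i le_ri) (yz i le_ri); case: (r != i) => [/eqP-> /eqP //|].
by case: (x i) (y i) (z i) => [] [] [].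
Qed.

Definition far (j : nat) x : T := [ffun i : 'I_a => x i (+) (i < j)].

Lemma dist_far j x : j <= a -> dist x (far j x) = j.
Proof.
move=> le_ja; apply/eqP; rewrite eqn_leq; apply/andP; split.
  by apply/dist_leP => i le_ji; rewrite ffunE ltnNge le_ji addbF.
case: j le_ja => // r lt_ra; rewrite ltnNge; apply/dist_leP => /(_ (Ordinal lt_ra)).
by rewrite ffunE /= ltnSn addbT => /(_ (leqnn _)); case: (x _).
Qed.

(** Addition in the vector space F_2^a; [translate (translate x y)] is thus the translation taking x
    to y. *)
Definition translate t x : T := [ffun i => x i (+) t i].

Lemma translateK t : involutive (translate t).
Proof. by move=> x; apply/ffunP => i; rewrite !ffunE addbK. Qed.

Lemma dist_translate t x y : dist (translate t x) (translate t y) = dist x y.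
Proof. by apply: eq_bigl => i; rewrite !ffunE; case: (x i) (y i) (t i) => [] [] []. Qed.

Lemma translate_diff x y : translate (translate x y) x = y.
Proof. by apply/ffunP => i; rewrite !ffunE addbC addbK. Qed.

Lemma dist_translate_diff x y w : dist w (translate (translate x y) w) = dist x y.
Proof. by apply: eq_bigl => i; rewrite !ffunE; case: (w i) (x i) (y i) => [] [] []. Qed.

(** * Isometries of the tree *)

Definition tree_isoms :=
  [set g : {perm T} | [forall x, forall y, dist (g x) (g y) == dist x y]].

Lemma tree_isomP g : reflect (forall x y, dist (g x) (g y) = dist x y) (g \in tree_isoms).
Proof.
rewrite inE; apply: (iffP 'forall_forallP) => H x y; first exact/eqP.
by rewrite H.
Qed.

Lemma tree_isoms_group_set : group_set tree_isoms.
Proof.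
apply/group_setP; split; first by apply/tree_isomP => x y; rewrite !perm1.
by move=> g h /tree_isomP gI /tree_isomP hI; apply/tree_isomP => x y; rewrite !permM hI.
Qed.

Canonical tree_isoms_group := Group tree_isoms_group_set.

(** If g^(2^i) maps each ball of radius a - i to itself, it fixes or swaps the two halves of the
    ball, so its square preserves each half. *)
Lemma tree_isom_expn_close g i x : g \in tree_isoms -> i <= a ->
  dist x ((g ^+ (2 ^ i))%g x) <= a - i.
Proof.
move=> gI; elim: i x => [|i IHi] x le_ia; first by rewrite subn0 dist_max.
pose h := (g ^+ (2 ^ i))%g; have /tree_isomP hI : h \in tree_isoms by rewrite groupX.
rewrite expnS mulnC expgM -/h expgS expg1 permM.
have dxh : dist x (h x) <= a - i by apply: IHi; lia.
have dhh : dist (h x) (h (h x)) = dist x (h x) by rewrite hI.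
have [e|ne] := eqVneq (dist x (h x)) (a - i).
  by apply: (@dist_binary _ _ (h x)); rewrite ?dhh; lia.
by apply: (@dist_trans _ (h x)); rewrite ?dhh; lia.
Qed.

(** At i = a the previous bound shows that the order of every element divides 2^a. *)
Lemma tree_isoms_pgroup : (2.-group tree_isoms)%g.
Proof.
apply/pgroupP => p p_pr /(Cauchy p_pr) [g gI ord_g].
have : #[g]%g %| 2 ^ a.
  rewrite order_dvdn; apply/eqP/permP => x; rewrite perm1.
  have := tree_isom_expn_close x gI (leqnn a).
  by rewrite subnn leqn0 dist_eq0 => /eqP.
by rewrite ord_g Euclid_dvdX // dvdn_prime2 // => /andP[].
Qed.

(* Adding the vector y - y' on the largest ball around y that avoids x exchanges
   y and y' and is still an isometry. *)
Lemma tree_isom_move x y y' : dist x y = dist x y' ->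
  exists2 g, g \in tree_isoms & g y = y' /\ forall w, dist x y <= dist w y -> g w = w.
Proof.
case d_xy: (dist x y) => [|r] d_xy'.
  exists 1%g; first exact: group1.
  split=> [|w _]; rewrite perm1 //.
  move/eqP: d_xy; rewrite dist_eq0 => /eqP <-.
  by apply/eqP; rewrite -dist_eq0 -d_xy'.
have d_yy' : dist y y' <= r by apply: (@dist_binary _ _ x); first rewrite distC.
pose s := translate (translate y y').
pose f w := if dist w y <= r then s w else w.
have d_s w : dist (s w) w <= r by rewrite distC dist_translate_diff.
have fK : involutive f.
  move=> w; rewrite /f; case: (leqP (dist w y) r) => [le_wr|lt_rw].
    by rewrite (dist_trans (d_s w) le_wr) /s translateK.
  by rewrite leqNgt lt_rw.
exists (perm (can_inj fK)); last first.
  split=> [|w lt_w]; rewrite permE /f ?distxx /= /s ?translate_diff //.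
  by rewrite leqNgt lt_w.
(* Here s moves u by at most r, while v is more than r away from u. *)
have iso1 u v : dist u y <= r -> r < dist v y -> dist (s u) v = dist u v.
  move=> le_u lt_v; apply: dist_isosceles; apply: leq_ltn_trans (d_s u) _.
  rewrite ltnNge; apply/negP => le_uv; move: lt_v; rewrite ltnNge => /negP; apply.
  by apply: dist_trans le_u; rewrite distC.
apply/tree_isomP => u v; rewrite !permE /f.
case: (leqP (dist u y) r) => Hu; case: (leqP (dist v y) r) => Hv //.
- exact: dist_translate.
- exact: iso1.
- by rewrite distC iso1 // distC.
Qed.

(** Translate x to x', then move y and z in turn. Since y' is nearer to x' than z' is, the last move
    leaves y' in place. *)
Lemma tree_isom_transitive x y z x' y' z' :
    dist x y = dist x' y' -> dist x z = dist x' z' -> dist x y < dist x z ->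
  exists2 g, g \in tree_isoms & [/\ g x = x', g y = y' & g z = z'].
Proof.
move=> dy dz lt_yz.
pose t := perm (can_inj (translateK (translate x x'))).
have tI : t \in tree_isoms by apply/tree_isomP => u v; rewrite !permE dist_translate.
have tx : t x = x' by rewrite permE translate_diff.
have d1 : dist x' (t y) = dist x' y' by rewrite -tx (tree_isomP _ tI) dy tx.
have [g gI [gy gfix]] := tree_isom_move d1.
have gx : g x' = x' by apply: gfix; rewrite leqnn.
have d2 : dist x' (g (t z)) = dist x' z'.
  by rewrite -[X in dist X _]gx (tree_isomP _ gI) -tx (tree_isomP _ tI) dz tx.
have [h hI [hz hfix]] := tree_isom_move d2.
exists (t * g * h)%g; first by rewrite !groupM.
split; rewrite !permM ?tx ?gx ?gy ?hz //; apply: hfix; rewrite ?leqnn //.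
rewrite d2 (@dist_isosceles y' x') ?d2 //.
by rewrite distC -dy -dz.
Qed.

(** The image of A under g; testing membership at g^-1 makes this a right action. *)
Definition transport (A : {set T * T * T}) g :=
  [set t | (g^-1 t.1.1, g^-1 t.1.2, g^-1 t.2)%g \in A].

Lemma transport1 : transport^~ 1%g =1 id.
Proof. by move=> A; apply/setP => -[[x y] z]; rewrite inE invg1 !perm1. Qed.

Lemma transportM A : act_morph transport A.
Proof. by move=> g h; apply/setP => -[[x y] z]; rewrite !inE invMg !permM. Qed.

Canonical transport_action := TotalAction transport1 transportM.

(** Models are closed under isomorphism, so the 2-group acts on them, and every orbit that is not a
    fixed point has even size. *)
Lemma odd_fixed_models phi :
  odd #|[set A : {set T * T * T} | models A phi]| =
  odd #|'Fix_([set A : {set T * T * T} | models A phi] | transport_action)(tree_isoms)%g|.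
Proof.
suff /(pgroup_fix_mod tree_isoms_pgroup) :
    [acts tree_isoms, on [set A : {set T * T * T} | models A phi] | transport_action].
  by rewrite !modn2 => /(can_inj oddb).
apply/actsP => g _ A; rewrite !inE; apply/esym/(models_iso (f := g^-1%g)).
  by exists g; [apply: permKV|apply: permK].
by move=> x y z; rewrite inE.
Qed.

Lemma invariantP (A : {set T * T * T}) :
  reflect (forall g, g \in tree_isoms ->
             forall x y z, ((g x, g y, g z) \in A) = ((x, y, z) \in A))
          (A \in 'Fix_transport_action(tree_isoms)%g).
Proof.
apply: (iffP afixP) => H g gI.
  by move=> x y z; rewrite -{1}(H g gI) inE /= !permK.
by apply/setP => -[[x y] z]; rewrite inE /= -(H g gI) !permKV.
Qed.

End Tree.

(** * The sentence *)

Local Notation sh := (lift ord0).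
Local Notation v0 := ord0.
Local Notation v1 := (sh v0).
Local Notation v2 := (sh v1).
Local Notation v3 := (sh v2).
Local Notation v4 := (sh v3).

(* The encoding: R x y z holds if x is the point branching off first, fails if y
   is, and is rho (d x y) (d x z) if z is, where d is the height of the least
   common ancestor.  The case x = y != z is included, with d x y = 0. *)
Definition oddF k (x y z : 'I_k) :=
  FAnd (FAnd (FRel x y z) (FRel x z y)) (FNot (FOr (FRel y x z) (FRel z x y))).

(* d x y < d x z, since this is when z branches off first. *)
Definition ltF k (x y z : 'I_k) := FAnd (FRel z x y) (FRel z y x).

Definition succF k (x y z : 'I_k) :=
  FAnd (ltF x y z) (FNot (FExists (FAnd (ltF (sh x) (sh y) v0) (ltF (sh x) v0 (sh z))))).

Definition iffF k (f g : formula k) := FAnd (FImp f g) (FImp g f).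

(** This does not axiomatize trees: it only asks each non-constant triple to have an odd point.
    Invariance under the automorphisms does the rest. *)
Definition treeF : sentence :=
  FForall (FForall (FForall
    (FOr (FAnd (FAnd (FEq v2 v1) (FEq v1 v0)) (FNot (FRel v2 v1 v0)))
      (FOr (oddF v2 v1 v0) (FOr (oddF v1 v2 v0) (oddF v0 v2 v1)))))).

(** For levels i < j < k with i related to j, it makes (j, k) and (i, k) equivalent. Given shift
    invariance, this closes the differences under addition and subtraction. *)
Definition subF : sentence :=
  FForall (FForall (FForall (FForall
    (FImp (FAnd (ltF v3 v2 v1) (FAnd (ltF v3 v1 v0) (FRel v3 v2 v1)))
      (iffF (FRel v3 v1 v0) (FRel v3 v2 v0)))))).

Definition shiftF : sentence :=
  FForall (FForall (FForall (FForall (FForall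
    (FImp (FAnd (ltF v4 v3 v2) (FAnd (succF v4 v3 v1) (succF v4 v2 v0)))
      (iffF (FRel v4 v3 v2) (FRel v4 v1 v0))))))).

(** The premise puts z at the top level a as seen from x, and the triple (x, x, z) encodes rho 0
    a. *)
Definition endF : sentence :=
  FForall (FForall
    (FImp (FNot (FExists (ltF v2 v1 v0))) (FRel v1 v1 v0))).

Definition square_sentence : sentence :=
  FAnd (FAnd treeF subF) (FAnd shiftF endF).

(** * Meaning of the formulas *)

Section Semantics.

Variables (T : finType) (A : {set T * T * T}).
Implicit Types x y z w : T.
Local Notation R x y z := ((x, y, z) \in A).

Definition odd_one x y z := [&& R x y z, R x z y, ~~ R y x z & ~~ R z x y].
Definition nearer x y z := R z x y && R z y x.
Definition covers x y z :=
  nearer x y z && ~~ [exists w, nearer x y w && nearer x w z].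

Lemma holds_oddF k (x y z : 'I_k) e :
  holds A (oddF x y z) e = odd_one (e x) (e y) (e z).
Proof. by rewrite /oddF /= negb_or /odd_one !andbA. Qed.

Lemma holds_ltF k (x y z : 'I_k) e :
  holds A (ltF x y z) e = nearer (e x) (e y) (e z).
Proof. by []. Qed.

Lemma holds_succF k (x y z : 'I_k) e :
  holds A (succF x y z) e = covers (e x) (e y) (e z).
Proof.
rewrite /covers /=; congr (_ && ~~ _); apply: eq_existsb => w.
by rewrite /= !env_consE.
Qed.

Lemma holds_iffF k (f g : formula k) e :
  holds A (iffF f g) e = (holds A f e == holds A g e).
Proof. by rewrite /iffF /=; case: (holds _ f _) (holds _ g _) => [] []. Qed.

Lemma holds_EqF k (x y : 'I_k) e : holds A (FEq x y) e = (e x == e y).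
Proof. by []. Qed.

Lemma holds_RelF k (x y z : 'I_k) e : holds A (FRel x y z) e = R (e x) (e y) (e z).
Proof. by []. Qed.

Lemma holds_NotF k (f : formula k) e : holds A (FNot f) e = ~~ holds A f e.
Proof. by []. Qed.

Lemma holds_AndF k (f g : formula k) e :
  holds A (FAnd f g) e = holds A f e && holds A g e.
Proof. by []. Qed.

Lemma holds_OrF k (f g : formula k) e :
  holds A (FOr f g) e = holds A f e || holds A g e.
Proof. by []. Qed.

Lemma holds_ImpF k (f g : formula k) e :
  holds A (FImp f g) e = holds A f e ==> holds A g e.
Proof. by []. Qed.

Lemma holds_ForallP k (f : formula k.+1) e :
  reflect (forall u, holds A f (env_cons u e)) (holds A (FForall f) e).
Proof. exact: forallP. Qed.

Lemma holds_ExistsP k (f : formula k.+1) e :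
  reflect (exists u, holds A f (env_cons u e)) (holds A (FExists f) e).
Proof. exact: existsP. Qed.

(** Compound formulas precede the connectives they unfold to, so as to be rewritten whole. *)
Definition holdsE :=
  (holds_oddF, holds_succF, holds_ltF, holds_iffF, holds_EqF, holds_RelF,
   holds_NotF, holds_AndF, holds_OrF, holds_ImpF, env_consE).

Lemma treeP : reflect (forall x y z,
    [|| [&& x == y, y == z & ~~ R x y z],
        odd_one x y z, odd_one y x z | odd_one z x y]) (models A treeF).
Proof.
apply: (iffP (holds_ForallP _ _)) => H x;
  last apply/holds_ForallP => y; last apply/holds_ForallP => z.
  move=> y z; move/holds_ForallP/(_ y)/holds_ForallP/(_ z): (H x).
  by rewrite !holdsE !andbA.
by have := H x y z; rewrite !holdsE !andbA.
Qed.

Lemma subP : reflect (forall x y z w,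
    nearer x y z -> nearer x z w -> R x y z -> R x z w = R x y w)
  (models A subF).
Proof.
apply: (iffP (holds_ForallP _ _)) => H x; last first.
  apply/holds_ForallP => y; apply/holds_ForallP => z; apply/holds_ForallP => w.
  by rewrite !holdsE; apply/implyP => /and3P[? ? ?]; apply/eqP/H.
move=> y z w lt_yz lt_zw Rxyz.
move/holds_ForallP/(_ y)/holds_ForallP/(_ z)/holds_ForallP/(_ w): (H x).
by rewrite !holdsE lt_yz lt_zw Rxyz => /eqP.
Qed.

Lemma shiftP : reflect (forall x y z y' z',
    nearer x y z -> covers x y y' -> covers x z z' -> R x y z = R x y' z')
  (models A shiftF).
Proof.
apply: (iffP (holds_ForallP _ _)) => H x; last first.
  apply/holds_ForallP => y; apply/holds_ForallP => z.
  apply/holds_ForallP => y'; apply/holds_ForallP => z'.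
  by rewrite !holdsE; apply/implyP => /and3P[? ? ?]; apply/eqP/H.
move=> y z y' z' lt_yz Syy' Szz'.
move/holds_ForallP/(_ y)/holds_ForallP/(_ z): (H x).
move/holds_ForallP/(_ y')/holds_ForallP/(_ z').
by rewrite !holdsE lt_yz Syy' Szz' => /eqP.
Qed.

Lemma endP : reflect (forall x z, (forall w, ~~ nearer x z w) -> R x x z)
  (models A endF).
Proof.
apply: (iffP (holds_ForallP _ _)) => H x; last first.
  apply/holds_ForallP => z; rewrite !holdsE; apply/implyP => /holds_ExistsP far_z.
  by apply: H => w; apply/negP => lt_zw; apply: far_z; exists w; rewrite !holdsE.
move=> z far_z; move/holds_ForallP/(_ z): (H x); rewrite !holdsE => /implyP; apply.
by apply/holds_ExistsP => -[w]; rewrite !holdsE (negPf (far_z w)).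
Qed.

Lemma models_square_sentence : models A square_sentence =
  [&& models A treeF, models A subF, models A shiftF & models A endF].
Proof. by rewrite andbA. Qed.

End Semantics.

(** * Invariant models *)

Section Models.

Variable a : nat.
Local Notation T := {ffun 'I_a -> bool}.
Implicit Types (x y z w : T) (A : {set T * T * T}).

Lemma ultrametric x y z : [/\ dist x z <= maxn (dist x y) (dist y z),
  dist x y <= maxn (dist x z) (dist y z) & dist y z <= maxn (dist x y) (dist x z)].
Proof.
split.
- by apply: (@dist_trans _ _ y); rewrite ?leq_maxl ?leq_maxr.
- by apply: (@dist_trans _ _ z); rewrite ?leq_maxl // distC leq_maxr.
- by apply: (@dist_trans _ _ x); rewrite ?leq_maxr // distC leq_maxl.
Qed.

(** In an ultrametric the two largest sides are equal, and binary branching excludes equilateral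
    triangles, so some side is strictly shortest. *)
Lemma odd_one_cases x y z :
  [\/ x = y /\ y = z, dist y z < dist x y, dist x z < dist y x | dist x y < dist z x].
Proof.
have [] := ultrametric x y z; have := @dist_binary _ _ x y z.
rewrite (distC y x) (distC z x).
case e: (dist x y) => [|r] bin *.
  move/eqP: e; rewrite dist_eq0 => /eqP e.
  have [/eqP|] := posnP (dist x z); last by move=> ?; apply: Or44.
  by rewrite dist_eq0 => /eqP <-; apply: Or41; rewrite e.
have [lt|gt|e'] := ltngtP (dist y z) r.+1; first exact: Or42.
  by apply: Or44; lia.
by apply: Or43; have := bin r erefl e'; lia.
Qed.

(** The encoding follows the actual tree. When x is the odd point, only the values at (y, z, x) and
    (z, y, x) stay free to carry rho. *)
Definition tree_like A :=
  (forall x, (x, x, x) \notin A) /\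
  (forall x y z, dist y z < dist x y -> odd_one A x y z).

(** If x or y is the odd point, one of the two conjuncts of [nearer] fails. *)
Lemma nearer_dist A x y z : tree_like A -> nearer A x y z = (dist x y < dist x z).
Proof.
move=> [An Ao]; have [lt_yz|ge_yz] := ltnP (dist x y) (dist x z).
  by move: lt_yz; rewrite (distC x z) => /Ao; rewrite /nearer => /and4P[-> ->].
apply/negbTE/andP => -[Rzxy Rzyx].
have [[eq_x eq_y]|/Ao|/Ao|] := odd_one_cases x y z.
- by move: Rzxy; rewrite eq_x eq_y (negPf (An z)).
- by case/and4P => _ _ _; rewrite Rzxy.
- by case/and4P => _ _ _; rewrite Rzyx.
- by rewrite (distC z); lia.
Qed.

Lemma covers_dist A x y z :
  tree_like A -> covers A x y z = (dist x z == (dist x y).+1).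
Proof.
move=> At; rewrite /covers nearer_dist //; apply/andP/eqP => [[lt_yz /existsPn noA]|e].
  have le_a := dist_max x z.
  (* A leaf on the very next level would lie strictly between if z were higher. *)
  have := noA (far (dist x y).+1 x).
  by rewrite !nearer_dist // dist_far; lia.
split; first lia.
by apply/existsPn => w; rewrite !nearer_dist //; lia.
Qed.

Lemma tree_like_eq A B : tree_like A -> tree_like B ->
    (forall x y z, dist x y < dist x z -> ((x, y, z) \in A) = ((x, y, z) \in B)) ->
  A = B.
Proof.
move=> [An Ao] [Bn Bo] AB; apply/setP => -[[x y] z].
have [[-> ->]|H|H|] := odd_one_cases x y z.
- by rewrite (negPf (An z)) (negPf (Bn z)).
- by case/and4P: (Ao _ _ _ H) => ->; case/and4P: (Bo _ _ _ H) => ->.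
- case/and4P: (Ao _ _ _ H) => _ _ /negPf-> _.
  by case/and4P: (Bo _ _ _ H) => _ _ /negPf-> _.
- by rewrite (distC z x); apply: AB.
Qed.

(** Here rho is congruence modulo d; the first disjunct is the case where x is the odd point. *)
Definition div_struct (d : nat) : {set T * T * T} :=
  [set t | let: (x, y, z) := t in
     (dist y z < dist x y) ||
     (dist x y < dist x z) && (d %| dist x z - dist x y)].

Lemma mem_div_struct d x y z : dist x y < dist x z ->
  ((x, y, z) \in div_struct d) = (d %| dist x z - dist x y).
Proof.
move=> lt_yz; rewrite inE lt_yz /=; apply: orb_idl.
by have [] := ultrametric x y z; lia.
Qed.

Lemma div_struct_tree_like d : tree_like (div_struct d).
Proof.
split=> [x|x y z lt_yz]; first by rewrite inE ltnn.
have [] := ultrametric x y z; rewrite /odd_one !inE.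
rewrite (distC y x) (distC z y) (distC z x) !negb_or !negb_and.
by move: (d %| _ - _) (d %| _ - _) (d %| _ - _) (d %| _ - _); lia.
Qed.

Lemma div_struct_models d : 0 < a -> d %| a -> models (div_struct d) square_sentence.
Proof.
move=> a0 dvd_da; have At := div_struct_tree_like d; have [An Ao] := At.
rewrite models_square_sentence; apply/and4P; split.
- apply/treeP => x y z.
  have [[-> ->]|/Ao->|/Ao->|/Ao->] := odd_one_cases x y z; rewrite ?orbT //.
  by rewrite eqxx (An z).
- apply/subP => x y z w; rewrite !nearer_dist // => lt_yz lt_zw.
  rewrite !mem_div_struct //; last exact: ltn_trans lt_zw.
  have -> : dist x w - dist x y = (dist x w - dist x z) + (dist x z - dist x y) by lia.
  by move=> dvd_d; rewrite dvdn_addl.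
- apply/shiftP => x y z y' z'; rewrite nearer_dist // !covers_dist //.
  by move=> lt_yz /eqP Syy' /eqP Szz'; rewrite !mem_div_struct ?Syy' ?Szz'.
(* Comparison with [far a x], on the top level, forces z to height a, which d divides. *)
- apply/endP => x z far_z; have := far_z (far a x).
  rewrite nearer_dist // dist_far // -leqNgt => le_az.
  have e : dist x z = a by have := dist_max x z; lia.
  by rewrite mem_div_struct distxx e ?subn0.
Qed.

Lemma div_struct_invariant d : div_struct d \in 'Fix_(transport_action a)(tree_isoms a)%g.
Proof. by apply/invariantP => g /tree_isomP gI x y z; rewrite !inE !gI. Qed.

Lemma div_struct_inj d d' : 0 < a -> d %| a -> d' %| a ->
  div_struct d = div_struct d' -> d = d'.
Proof.
move=> a0 dvd_d dvd_d' eq_dd'; apply/eqP; rewrite eqn_dvd.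
suff dvdE c c' : c %| a -> div_struct c = div_struct c' -> c' %| c.
  by rewrite (dvdE d') ?(dvdE d).
move=> dvd_c eq_c; pose x : T := [ffun=> false].
have c0 : 0 < c := dvdn_gt0 a0 dvd_c.
have dx : dist x (far c x) = c by rewrite dist_far // dvdn_leq.
(* Evaluate both relations at the levels 0 and c. *)
have := mem_div_struct c' (x := x) (y := x) (z := far c x).
rewrite -eq_c mem_div_struct distxx dx // subn0 dvdnn.
by move=> /(_ c0).
Qed.

(** An automorphism fixing x and swapping y and z exists, whereas y or z being odd for A would break
    that symmetry. *)
Lemma invariant_tree_like A : A \in 'Fix_(transport_action a)(tree_isoms a)%g ->
  models A treeF -> tree_like A.
Proof.
move=> /invariantP AI /treeP At; split=> [x|x y z lt_yz].
  by move: (At x x x); rewrite /odd_one eqxx; case: (_ \in A).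
have eqR : ((y, z, x) \in A) = ((z, y, x) \in A).
  have lt_zx : dist y z < dist y x by rewrite (distC y x).
  have eq_x : dist y x = dist z x.
    by have [] := ultrametric x y z; rewrite (distC y x) (distC z x); lia.
  have [g gI [gy gz gx]] := tree_isom_transitive (distC y z) eq_x lt_zx.
  by rewrite -(AI _ gI) gy gz gx.
have /or4P[/and3P[/eqP eq_x /eqP eq_y _]|//|/and4P[_]|/and4P[_]] := At x y z.
- by move: lt_yz; rewrite eq_x eq_y ltnn.
- by rewrite eqR => ->.
- by rewrite eqR => ->.
Qed.

Lemma invariant_model A : 0 < a -> A \in 'Fix_(transport_action a)(tree_isoms a)%g ->
  models A square_sentence -> exists2 d, d %| a & A = div_struct d.
Proof.
move=> a0 Ainv; rewrite models_square_sentence.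
move=> /and4P[Atree /subP Asub /shiftP Ashift /endP Aend].
have At := invariant_tree_like Ainv Atree; move/invariantP: Ainv => AI.
pose o : T := [ffun=> false]; pose D k := (o, o, far k o) \in A.
have AD x y z : dist x y < dist x z ->
    ((x, y, z) \in A) = D (dist x z - dist x y).
  move dxy : (dist x y) => i.
  elim: i x y z dxy => [|i IHi] x y z dxy lt_yz.
    move/eqP: (dxy); rewrite dist_eq0 => /eqP eq_xy; rewrite -eq_xy subn0.
    have [g gI [gx _ gz]] : exists2 g, g \in tree_isoms a &
        [/\ g x = o, g x = o & g z = far (dist x z) o].
      by apply: tree_isom_transitive; rewrite ?dist_far ?dist_max ?distxx.
    by rewrite -(AI _ gI) gx gz.
  have le_za := dist_max x z; have le_ya := dist_max x y.
  (* Shift both levels down by one, representing the lower levels by [far] leaves. *)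
  rewrite -(@Ashift x (far i x) (far (dist x z).-1 x)); first last.
  - by rewrite covers_dist // dist_far ?prednK; lia.
  - by rewrite covers_dist // dist_far ?dxy; lia.
  - by rewrite nearer_dist // !dist_far; lia.
  rewrite IHi ?dist_far //; try lia.
  by congr D; lia.
have far_o k : k <= a -> dist o (far k o) = k by apply: dist_far.
have [|i k i0 k0 le_ika Di|d dvd_da DE] := @difference_set_multiples a D a0.
- by apply: Aend => w; rewrite nearer_dist // far_o // -leqNgt dist_max.
- have le_ia : i <= a by lia.
  (* Apply [subF] at the levels 0 < i < i + k; by [AD] the left side is [D k]. *)
  have eqA : ((o, far i o, far (i + k) o) \in A) = ((o, o, far (i + k) o) \in A).
    by apply: Asub => //; rewrite nearer_dist // ?distxx !far_o //; lia.
  by move: eqA; rewrite AD !far_o // ?addKn; last lia.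
exists d => //; apply: tree_like_eq => // [|x y z lt_yz].
  exact: div_struct_tree_like.
rewrite AD // mem_div_struct // DE ?subn_gt0 //.
by rewrite (leq_trans (leq_subr _ _)) ?dist_max.
Qed.

End Models.

(** The relations [div_struct a d] with d | a list the invariant models without repetition. *)
Lemma odd_Sp_pow2 a : 0 < a ->
  odd (Sp square_sentence (2 ^ a)) = odd #|[set d : 'I_a.+1 | d %| a]|.
Proof.
move=> a0; have <- : #|{ffun 'I_a -> bool}| = 2 ^ a.
  by rewrite card_ffun card_bool card_ord.
rewrite Sp_card odd_fixed_models; congr odd.
rewrite -(card_in_imset (f := fun d : 'I_a.+1 => div_struct a d)); last first.
  by move=> d d'; rewrite !inE => dvd dvd' /div_struct_inj/val_inj; apply.
apply: eq_card => A; apply/setIP/imsetP => [[]|[d]].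
  rewrite inE => Amod /(invariant_model a0)/(_ Amod)[d dvd_d ->].
  have lt_d : d < a.+1 by rewrite ltnS dvdn_leq.
  by exists (Ordinal lt_d); rewrite ?inE.
rewrite inE => dvd_d ->; split; last exact: div_struct_invariant.
by rewrite inE div_struct_models.
Qed.

Theorem theorem6p3 :
  exists phi : sentence, ~ MC_finite (fun n : nat => Posz (Sp phi n)).
Proof.
exists square_sentence; apply: odd_squares_not_MC_finite => a a0.
by rewrite odd_Sp_pow2 ?odd_card_divisors.
Qed.
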